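(* The knife-edge billiard in the disk of radius $R$ admits a family of generalized caustics $\mathcal F=\{\mathcal C(z^+)\}_{z^+\in\mathcal I^+}$, where $\mathcal C(z^+)=\mathcal C^0(z^+)\cup\mathcal C^1(z^+)$. More precisely, if $z_0^+\in\mathcal I^+$ and $z_j^+=\mathrm T^j(z_0^+)$ for $j\in\mathbb Z$, then, for every $i\in\mathbb Z$, the following statements hold: - The trace of the midpoint $p(t)\in\mathbb D$ under the smooth dynamics with initial state $z_{2i}^+\in\mathcal I^+$ is tangent to $\mathcal C^0(z_0^+)$. - The trace of the midpoint $p(t)\in\mathbb D$ under the smooth dynamics with initial state $z_{2i+1}^+\in\mathcal I^+$ is tangent to $\mathcal C^1(z_0^+)$. Moreover, the midpoint corresponding to the state $z_i^+\in\mathcal I^+$ lies on a circle for all $i\in\mathbb Z$.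
   Context: Let $R,\ell,m,J>0$, $\mathbb S^1=\mathbb R/2\pi\mathbb Z$, $\mathbb T^2=\mathbb S^1\times\mathbb S^1$, and let $\mathbb D$ be the disk of radius $R$ centered at the origin (the billiard table). **The system.** The knife-edge is a rigid segment of length $2\ell$, mass $m$, moment of inertia $J$ about its midpoint, with center of mass at the midpoint. Its configuration is $q=(\theta,p)\in SE(2)$, with orientation $\theta$ and midpoint $p=(x,y)$. The Lagrangian is $\frac12(J\dot\theta^2+m(\dot x^2+\dot y^2))$, and the nonholonomic constraint is $-\dot x\sin\theta+\dot y\cos\theta=0$. The quasi-velocities are $\omega=\dot\theta$ and $v=\dot x\cos\theta+\dot y\sin\theta$. The endpoints are the front point $p_f=p+\ell(\cos\theta,\sin\theta)$ and the back point $p_b=p-\ell(\cos\theta,\sin\theta)$. With $h(q)=\max\{\|p_f\|^2,\|p_b\|^2\}$, the impact surface is $\{h=R^2\}$. Impacts are elastic (energy preserving). In an impact state exactly one endpoint lies on the boundary of the disk and the rest of the knife-edge lies strictly inside. **Impact states.** Write $z=([\phi],[\vartheta],\omega,v)\in\mathbb T^2\times(\mathbb R^2\setminus\{(0,0)\})$, where $R(\cos\phi,\sin\phi)$ is the boundary point touched and $\vartheta=\phi-\theta$. Set $\mathcal I_f=\{z:\ell/R<\cos\vartheta\}$ (front-type: $p_f$ is on the boundary), $\mathcal I_b=\{z:\ell/R<-\cos\vartheta\}$ (back-type: $p_b$ is on the boundary), and $\mathcal I=\mathcal I_f\cup\mathcal I_b$. The point $z$ corresponds to the configuration with orientation $\theta(z)=\phi-\vartheta$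 and midpoint $p(z)=R(\cos\phi,\sin\phi)\mp\ell(\cos(\phi-\vartheta),\sin(\phi-\vartheta))$ ($-$ for front-type, $+$ for back-type), with quasi-velocities $(\omega,v)$. The regular pre-impact states $\mathcal{RI}^-$, regular post-impact states $\mathcal{RI}^+$ and tangential states $\mathcal{TI}$ are those $z\in\mathcal I$ with $dh(\dot q)>0$, $dh(\dot q)<0$ and $dh(\dot q)=0$, respectively. Here $dh(\dot q)$ is a positive multiple of $\ell\omega\sin\vartheta+v\cos\vartheta$ on $\mathcal I_f$ and of $v\cos\vartheta-\ell\omega\sin\vartheta$ on $\mathcal I_b$. Set $\mathcal I^\pm=\mathcal{RI}^\pm\cup\mathcal{TI}$, $\mathcal I^-_f=\mathcal I^-\cap\mathcal I_f$, $\mathcal I^-_b=\mathcal I^-\cap\mathcal I_b$. **Smooth dynamics.** The smooth dynamics with initial state $z^+\in\mathcal I^+$ is the motion $(\theta(t),p(t))$ following the impact, given by the nonholonomic equations $\dot\theta=\omega$, $\dot p=v(\cos\theta,\sin\theta)$ with $\omega,v$ constant, starting at $(\theta(z^+),p(z^+))$. **The map $\mathrm T$.** Let $\mathcal{RI}_v^+=\{z\in\mathcal{RI}^+:\omega=0\}$ (on $\mathcal I^+\setminus\mathcal{RI}_v^+$ one has $\omega\neq0$). For $z\in\mathcal I^+\setminus\mathcal{RI}_v^+$ let $\mathrm c(z)=p(z)+\frac v\omega(-\sin(\phi-\vartheta),\cos(\phi-\vartheta))$, $d(z)=\|\mathrm c(z)\|$, $r(z)=\sqrt{(v/\omega)^2+\ell^2}$,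 $\alpha(z)=\arccos\frac{d^2+R^2-r^2}{2dR}$. Define $\Omega:\mathcal I^+\to\mathbb S^1$ by $\Omega(z)=[-2\,\mathrm{sgn}(\omega)\alpha(z)]$ if $z\notin\mathcal{RI}_v^+$ and $\Omega(z)=[-2\vartheta+\pi]$ if $z\in\mathcal{RI}_v^+$. Define $\mathrm{Ro}:\mathcal I^+\to\mathcal I^-$ by $\mathrm{Ro}(z)=([\phi]+\Omega(z),[-\vartheta+\pi],\omega,v)$. With $\mathrm D(\vartheta)=\frac{\ell^2}{J}\sin^2\vartheta+\frac1m\cos^2\vartheta$, the impact map $\mathrm I:\mathcal I^-\to\mathcal I^+$ is $\mathrm I(z)=(\phi,\vartheta,\mathcal R_f^\vartheta(\omega,v))$ if $z\in\mathcal I_f^-$ and $\mathrm I(z)=(\phi,\vartheta,\mathcal R_b^\vartheta(\omega,v))$ if $z\in\mathcal I_b^-$, where (row vector times matrix) $$\mathcal R_f^\vartheta(\omega,v)=(\omega,v)\begin{pmatrix}1-\frac{2\ell^2\sin^2\vartheta}{J\mathrm D(\vartheta)}&-\frac{2\ell\cos\vartheta\sin\vartheta}{m\mathrm D(\vartheta)}\\-\frac{2\ell\cos\vartheta\sin\vartheta}{J\mathrm D(\vartheta)}&1-\frac{2\cos^2\vartheta}{m\mathrm D(\vartheta)}\end{pmatrix},$$ and $\mathcal R_b^\vartheta$ is given by the same matrix with both off-diagonal entries replaced by their negatives. Set $\mathrm T=\mathrm I\circ\mathrm{Ro}:\mathcal I^+\to\mathcal I^+$. If $z_j^+$ denotes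 the $j$-th post-impact state of the billiard, then $z_{j+1}^+=\mathrm T(z_j^+)$. **Caustics.** Define $\mathrm f:\mathcal I^+\to[0,R)$ by $$\mathrm f(z)=\begin{cases}\big|d(z)-|v/\omega|\big|,&\omega v\neq0,\\ R|\sin\vartheta|,&z\in\mathcal{RI}_v^+\ (\omega=0),\\ |d(z)-\ell|,&v=0.\end{cases}$$ Set $\mathcal C^0(z)=\{(x,y)\in\mathbb R^2:x^2+y^2=\mathrm f(z)^2\}$ and $\mathcal C^1(z)=\{(x,y)\in\mathbb R^2:x^2+y^2=\mathrm f(\mathrm T(z))^2\}$.
   Formalization: For states with v=0 the midpoint is at rest, generally off the circle of radius |d-ℓ|, so there the formal statement asserts tangency of the traces of both endpoints instead of the midpoint; for a caustic of radius 0, tangent means passing through the origin. *)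

(* Defs.v *)
From HB Require Import structures.
From mathcomp Require Import all_boot all_order all_algebra generic_quotient.
From mathcomp Require Import ring_quotient.
From mathcomp Require Import all_classical all_reals all_analysis.
Import Order.TTheory GRing.Theory Num.Theory.
Import numFieldNormedType.Exports.

Set Implicit Arguments.
Unset Strict Implicit.
Unset Printing Implicit Defensive.

Local Open Scope classical_set_scope.
Local Open Scope ring_scope.
Local Open Scope quotient_scope.

(* The circle of angles R / 2 pi Z, as a quotient group. *)

Definition twopiZ (R : realType) : {pred R} :=
  fun x => x / (2 * pi) \is a Num.int.

Lemma twopiZ_zmod_closed (R : realType) : zmod_closed (@twopiZ R).
Proof.
split=> [|x y hx hy]; last first.
  suff : (x - y) / (2 * pi) \is a Num.int by [].
  by rewrite mulrBl rpredB.
suff : (0 : R) / (2 * pi) \is a Num.int by [].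
by rewrite mul0r rpred0.
Qed.

HB.instance Definition _ (R : realType) :=
  GRing.isZmodClosed.Build R (@twopiZ R) (@twopiZ_zmod_closed R).

Notation S1 R := (Quotient.quot (@twopiZ R)).

Definition angle (R : realType) (x : R) : S1 R := \pi_(S1 R) x.
Definition cosS (R : realType) (a : S1 R) : R := cos (repr a).
Definition sinS (R : realType) (a : S1 R) : R := sin (repr a).

(* The library norm of R * R is the sup norm. *)
Definition norm2 (R : realType) (a : R * R) : R :=
  Num.sqrt (a.1 ^+ 2 + a.2 ^+ 2).

Definition disk (R : realType) (rad : R) : set (R * R) :=
  [set a | norm2 a <= rad].

Definition circle (R : realType) (a : R * R) (rho : R) : set (R * R) :=
  [set b | norm2 (b - a) = rho].

(* First-order contact at time t of the plane curve (x, y) with S, for S a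
   union of circles centred at the origin: the (nonzero) velocity is
   orthogonal to the radius.  When the circle degenerates to the origin,
   this means that the curve passes through the origin. *)
Definition tangent_at (R : realType) (x y : R -> R) (S : set (R * R)) (t : R) :
    Prop :=
  [/\ S (x t, y t), derivable x t 1, derivable y t 1,
      ('D_1 x t, 'D_1 y t) <> (0, 0)
    & x t * 'D_1 x t + y t * 'D_1 y t = 0].

(* The curve is followed for t >= 0, and the contact takes place in the
   billiard table. *)
Definition tangent_in_disk (R : realType) (rad : R) (x y : R -> R)
    (S : set (R * R)) : Prop :=
  exists t : R, [/\ 0 <= t, disk rad (x t, y t) & tangent_at x y S t].


Record state (R : realType) := State {
  phi : S1 R;
  vth : S1 R;
  omega : R;
  vel : R
}.

Section KnifeEdge.
Context (R : realType).
(* radius of the table; half-length, mass and moment of inertia of the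
   knife-edge *)
Context (rad len mass inertia : R).
Implicit Types z : state R.

Definition front z : bool :=
  ((omega z, vel z) != (0, 0)) && (len / rad < cosS (vth z)).
Definition back z : bool :=
  ((omega z, vel z) != (0, 0)) && (len / rad < - cosS (vth z)).

(* dh(q') up to the positive factor 2 * rad: it is the scalar product of the
   touched boundary point and the velocity of the endpoint touching it,
   divided by rad. *)
Definition dh z : R :=
  if front z then len * omega z * sinS (vth z) + vel z * cosS (vth z)
  else vel z * cosS (vth z) - len * omega z * sinS (vth z).

Definition impact z : bool := front z || back z.
Definition RIminus z : bool := impact z && (0 < dh z).
Definition RIplus z : bool := impact z && (dh z < 0).
Definition TI z : bool := impact z && (dh z == 0).
Definition Iminus z : bool := RIminus z || TI z.
Definition Iplus z : bool := RIplus z || TI z.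
Definition RIv_plus z : bool := RIplus z && (omega z == 0).

Definition orientation z : S1 R := phi z - vth z.

Definition midpoint z : R * R :=
  let s : R := if front z then -1 else 1 in
  (rad * cosS (phi z) + s * len * cosS (orientation z),
   rad * sinS (phi z) + s * len * sinS (orientation z)).

Definition rot_center z : R * R :=
  midpoint z + (vel z / omega z * - sinS (orientation z),
                vel z / omega z * cosS (orientation z)).

Definition dist z : R := norm2 (rot_center z).

Definition end_radius z : R := Num.sqrt ((vel z / omega z) ^+ 2 + len ^+ 2).

Definition alpha z : R :=
  acos ((dist z ^+ 2 + rad ^+ 2 - end_radius z ^+ 2) / (2 * dist z * rad)).

Definition Omega z : S1 R :=
  if RIv_plus z then - (vth z *+ 2) + angle pi
  else angle (- (2 * Num.sg (omega z) * alpha z)).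

Definition Ro z : state R :=
  State (phi z + Omega z) (- vth z + angle pi) (omega z) (vel z).

Definition Dcoef (a : S1 R) : R :=
  len ^+ 2 / inertia * sinS a ^+ 2 + 1 / mass * cosS a ^+ 2.

(* The impact matrix; s is 1 for front-type and -1 for back-type impacts. *)
Definition impact_mx (s : R) (a : S1 R) : 'M[R]_2 :=
  \matrix_(i < 2, j < 2)
    if i == 0 then
      if j == 0 then 1 - 2 * len ^+ 2 * sinS a ^+ 2 / (inertia * Dcoef a)
      else - (s * (2 * len * cosS a * sinS a / (mass * Dcoef a)))
    else
      if j == 0 then - (s * (2 * len * cosS a * sinS a / (inertia * Dcoef a)))
      else 1 - 2 * cosS a ^+ 2 / (mass * Dcoef a).

Definition impact_map z : state R :=
  let w := (\row_(j < 2) (if j == 0 then omega z else vel z))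
             *m impact_mx (if front z then 1 else -1) (vth z) in
  State (phi z) (vth z) (w 0 0) (w 0 1).

Definition T z : state R := impact_map (Ro z).

(* Inverse of the bijection T of Iplus; the default id is only used outside
   the image of Iplus. *)
Definition Tinv : state R -> state R := 'pinv_id [set z | Iplus z] T.

Definition Tpow (j : int) z : state R :=
  match j with
  | Posz n => iter n T z
  | Negz n => iter n.+1 Tinv z
  end.

(* th is a real lift of the orientation. *)
Definition smooth_dynamics z (th x y : R -> R) : Prop :=
  [/\ angle (th 0) = orientation z,
      (x 0, y 0) = midpoint z,
      forall t : R, is_derive t (1 : R) th (omega z),
      forall t : R, is_derive t (1 : R) x (vel z * cos (th t))
    & forall t : R, is_derive t (1 : R) y (vel z * sin (th t))].

Definition fcaustic z : R :=
  if RIv_plus z then rad * `|sinS (vth z)|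
  else if vel z == 0 then `|dist z - len|
  else `|dist z - `|vel z / omega z| |.

Definition C0 z : set (R * R) :=
  [set a | a.1 ^+ 2 + a.2 ^+ 2 = fcaustic z ^+ 2].
Definition C1 z : set (R * R) :=
  [set a | a.1 ^+ 2 + a.2 ^+ 2 = fcaustic (T z) ^+ 2].
Definition caustic z : set (R * R) := C0 z `|` C1 z.

(* When v = 0 the midpoint stays at rest at rot_center z and its trace is a
   single point, not on the circle of radius |dist z - len| in general: that
   radius is the one for which the circle is tangent to the circle traced by
   the two endpoints, and this is the tangency asserted in that case. *)
Definition trace_tangent z (S : set (R * R)) : Prop :=
  forall th x y : R -> R, smooth_dynamics z th x y ->
    (vel z <> 0 -> tangent_in_disk rad x y S) /\
    (vel z = 0 ->
      tangent_in_disk rad (fun t => x t + len * cos (th t))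
                          (fun t => y t + len * sin (th t)) S /\
      tangent_in_disk rad (fun t => x t - len * cos (th t))
                          (fun t => y t - len * sin (th t)) S).

End KnifeEdge.

(* Main.v *)
Require Import Defs.
From mathcomp Require Import all_boot all_order all_algebra.
From mathcomp Require Import generic_quotient ring_quotient ring lra zify.
From mathcomp Require Import all_classical all_reals all_analysis.
Import Order.TTheory GRing.Theory Num.Theory.
Import numFieldNormedType.Exports.

(** The rotations of the disk act on states by translating [phi], and the billiard
    map [T] commutes with them, since the angle [Omega] is computed from rotation
    invariant data.  The heart of the matter is that, up to such a rotation, [T]
    is an involution.  Rolling replaces [vth] by [pi - vth] and exchanges the two
    ends of the knife-edge, so that the covector [normal], whose pairing with the
    velocity is [dh], changes sign.  An impact applies to the velocity the
    reflection along that covector in the kinetic metric, an involution which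
    depends on the covector only up to sign.  Hence two successive impacts apply
    the same reflection twice: [T (T z)] has the [vth], [omega] and [vel] of [z],
    and differs from [z] by its [phi] only ([TT_rotate]).  It follows formally
    that [T] is injective, that its inverse agrees with [T] up to a rotation,
    and that the whole orbit of [z] consists of rotated copies of [z] and [T z]
    ([T_inj], [Tinv_rotate], [Tpow_rotate]).

    As [fcaustic] is rotation invariant, what remains is the tangency to [C0 z]
    of the motion issued from one state [z] ([trace_tangent_C0]).  If [omega] is
    not zero, the midpoint (or each endpoint, when [vel] is zero) runs along a
    full circle, whose centre is at distance [d] from the origin; the point of
    that circle closest to the origin is at distance [|d - radius|], its
    velocity is orthogonal to its position, and it is visited in every period
    ([circular_motion_tangent]).  If [omega] is zero, the midpoint runs along a
    line, and the sign condition on [dh] says that it approaches the foot of the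
    perpendicular from the origin ([trace_tangent_C0_linear]).

    Finally the distance from the midpoint to the origin depends only on
    [side * cos vth], which [T] preserves, so all midpoints lie on a circle
    centred at the origin. *)

Set Implicit Arguments.
Unset Strict Implicit.
Unset Printing Implicit Defensive.

Local Open Scope classical_set_scope.
Local Open Scope ring_scope.

(** * Trigonometric functions on the circle of angles *)

Section Angles.
Context {R : realType}.
Implicit Types (x : R) (a b : S1 R).

Lemma trigD2npi x (m : int) :
  cos (x + 2 * pi * m%:~R) = cos x /\ sin (x + 2 * pi * m%:~R) = sin x.
Proof.
have pos n (y : R) :
    cos (y + 2 * pi * n%:R) = cos y /\ sin (y + 2 * pi * n%:R) = sin y.
  rewrite mulr_natl mulr_natr.
  by rewrite (periodicn (@cosD2pi R)) (periodicn (@sinD2pi R)).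
case: m => n; first exact: pos.
rewrite NegzE mulrNz; have := pos n.+1 (x + 2 * pi * - n.+1%:R).
by rewrite -addrA -mulrDr addNr mulr0 addr0 => -[-> ->].
Qed.

(** [repr] picks some representative of a class modulo [2 * pi], possibly not
    [x], so periodicity is what makes [cosS] and [sinS] compute on [angle x]. *)
Lemma angleK x : cosS (angle x) = cos x /\ sinS (angle x) = sin x.
Proof.
have /intrP[m hm] : repr (angle x) - x \in @twopiZ R.
  by rewrite Quotient.idealrBE reprK.
have pi2 : (2 * pi : R) != 0 by rewrite mulf_neq0 // gt_eqF // pi_gt0.
rewrite /cosS /sinS -[repr _](subrK x) -[repr _ - x](divfK pi2) hm.
by rewrite mulrC addrC; exact: trigD2npi.
Qed.

Lemma cosS_angle x : cosS (angle x) = cos x.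
Proof. by case: (angleK x). Qed.

Lemma sinS_angle x : sinS (angle x) = sin x.
Proof. by case: (angleK x). Qed.

Lemma angle_repr a : angle (repr a) = a.
Proof. exact: reprK. Qed.

Lemma angleD x y : angle (x + y) = angle x + angle y.
Proof. exact: raddfD. Qed.

Lemma angleN x : angle (- x) = - angle x.
Proof. exact: raddfN. Qed.

Lemma cosSD a b : cosS (a + b) = cosS a * cosS b - sinS a * sinS b.
Proof.
rewrite -(angle_repr a) -(angle_repr b) -angleD.
by rewrite !(cosS_angle, sinS_angle) cosD.
Qed.

Lemma sinSD a b : sinS (a + b) = sinS a * cosS b + cosS a * sinS b.
Proof.
rewrite -(angle_repr a) -(angle_repr b) -angleD.
by rewrite !(cosS_angle, sinS_angle) sinD.
Qed.

Lemma cosSN a : cosS (- a) = cosS a.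
Proof. by rewrite -(angle_repr a) -angleN !cosS_angle cosN. Qed.

Lemma sinSN a : sinS (- a) = - sinS a.
Proof. by rewrite -(angle_repr a) -angleN !sinS_angle sinN. Qed.

Lemma cosS2DsinS2 a : cosS a ^+ 2 + sinS a ^+ 2 = 1.
Proof. exact: cos2Dsin2. Qed.

Lemma cosS_pi_sub a : cosS (- a + angle pi) = - cosS a.
Proof.
by rewrite cosSD cosSN cosS_angle sinS_angle cospi sinpi mulrN1 mulr0 subr0.
Qed.

Lemma sinS_pi_sub a : sinS (- a + angle pi) = sinS a.
Proof.
rewrite sinSD sinSN cosS_angle sinS_angle cospi sinpi.
by rewrite mulrNN mulr1 mulr0 addr0.
Qed.

End Angles.

(** * Contact of a plane curve with a circle centred at the origin *)

Section Tangency.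
Context {R : realType}.
Implicit Types (a b t om rho rad : R) (p q : R * R) (f g h x y : R -> R).

Lemma norm2_ge0 p : 0 <= norm2 p.
Proof. exact: sqrtr_ge0. Qed.

Lemma sqr_norm2 p : norm2 p ^+ 2 = p.1 ^+ 2 + p.2 ^+ 2.
Proof. by rewrite sqr_sqrtr // addr_ge0 ?sqr_ge0. Qed.

Lemma norm2N p : norm2 (- p) = norm2 p.
Proof. by rewrite /norm2 /= !sqrrN. Qed.

Lemma norm2_polar p : exists a b,
  a ^+ 2 + b ^+ 2 = 1 /\ p = (norm2 p * a, norm2 p * b).
Proof.
have [p0|p_neq0] := eqVneq (norm2 p) 0.
  (* any direction fits the origin *)
  exists 1, 0; split; first by rewrite expr1n expr0n addr0.
  have /eqP := sqr_norm2 p.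
  rewrite p0 expr0n eq_sym paddr_eq0 ?sqr_ge0 // !sqrf_eq0.
  move=> /andP[/eqP p1 /eqP p2].
  by rewrite !mul0r; apply: injective_projections.
exists (p.1 / norm2 p), (p.2 / norm2 p); split.
  by rewrite !expr_div_n -mulrDl -sqr_norm2 divff // expf_neq0.
by apply: injective_projections => /=; rewrite mulrC divfK.
Qed.

Lemma ler_norm2D p q : norm2 (p + q) <= norm2 p + norm2 q.
Proof.
have n0 : 0 <= norm2 p + norm2 q by rewrite addr_ge0 ?norm2_ge0.
rewrite -ler_sqr ?nnegrE ?norm2_ge0 // sqrrD !sqr_norm2 /=.
suff : p.1 * q.1 + p.2 * q.2 <= norm2 p * norm2 q by move=> ?; lra.
apply: le_trans (ler_norm _) _.
rewrite -ler_sqr ?nnegrE ?normr_ge0 ?mulr_ge0 ?norm2_ge0 //.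
rewrite real_normK ?num_real // exprMn !sqr_norm2 -subr_ge0.
have -> : (p.1 ^+ 2 + p.2 ^+ 2) * (q.1 ^+ 2 + q.2 ^+ 2) -
    (p.1 * q.1 + p.2 * q.2) ^+ 2 = (p.1 * q.2 - p.2 * q.1) ^+ 2 by ring.
exact: sqr_ge0.
Qed.

Lemma ler_dist_norm2 p q : `|norm2 p - norm2 q| <= norm2 (p - q).
Proof.
have := ler_norm2D (p - q) q; have := ler_norm2D (q - p) p.
rewrite -[q - p]opprB norm2N opprB (subrK p q) (subrK q p) ler_distl.
by move=> ? ?; apply/andP; split; lra.
Qed.

Lemma angle_of_unit a b : a ^+ 2 + b ^+ 2 = 1 ->
  exists g : R, cos g = a /\ sin g = b.
Proof.
move=> ab1.
have a1 : -1 <= a <= 1 by apply/andP; split; nra.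
have ca : cos (acos a) = a by rewrite acosK.
have sa : sin (acos a) = `|b|.
  by rewrite sin_acos // -ab1 addrAC subrr add0r sqrtr_sqr.
have [b0|b0] := leP 0 b.
  by exists (acos a); rewrite sa ger0_norm.
by exists (- acos a); rewrite cosN sinN sa ltr0_norm // opprK.
Qed.

(** A uniform rotation takes every direction once in each period, hence also after
    time 0. *)
Lemma hitting_time th0 om a b : om != 0 -> a ^+ 2 + b ^+ 2 = 1 ->
  exists t, [/\ 0 <= t, cos (th0 + om * t) = a & sin (th0 + om * t) = b].
Proof.
move=> om0 /angle_of_unit[g [ca sb]].
(* [t0] is one solution, possibly negative; whole periods [P] are added to it *)
pose t0 := (g - th0) / om.
pose P : R := 2 * pi / `|om|.
have P0 : 0 < P by rewrite divr_gt0 ?normr_gt0 // mulr_gt0 // pi_gt0.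
pose n := Num.bound (`|t0| / P).
exists (t0 + P * n%:R).
have -> : th0 + om * (t0 + P * n%:R) = g + 2 * pi * (sgz om * n%:Z)%:~R.
  have omN0 : `|om| != 0 by rewrite normr_eq0.
  have sgE : Num.sg om = om / `|om| by rewrite {2}[om]numEsg mulfK.
  rewrite intrM -sgrEz sgE /t0 /P; move: `|om| omN0 => u u0.
  by field; rewrite om0 u0.
have [-> ->] := trigD2npi g (sgz om * n%:Z).
split => //.
have : `|t0| / P < n%:R.
  by apply: archi_boundP; rewrite divr_ge0 // ltW.
rewrite ltr_pdivrMr // mulrC => /ltW; have := ler_norm (- t0); rewrite normrN.
by move=> ? ?; lra.
Qed.

Lemma eq_of_is_derive f g h : (forall t, is_derive t 1 f (h t)) ->
  (forall t, is_derive t 1 g (h t)) -> f 0 = g 0 -> f = g.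
Proof.
move=> df dg fg0; apply/funext => t; apply/eqP; rewrite -subr_eq0; apply/eqP.
have -> : f t - g t = (f \- g) t by [].
have -> : (f \- g) t = (f \- g) 0.
  apply: is_derive_0_is_cst => s.
  by apply: is_derive_eq; rewrite subrr.
by rewrite /= fg0 subrr.
Qed.

Lemma is_derive_affine a b t : is_derive t 1 (fun s => a + b * s) b.
Proof. by apply: is_derive_eq; rewrite add0r mul1r [_ *: _]mulr1. Qed.

Lemma is_derive_cos_affine a b t :
  is_derive t 1 (fun s => cos (a + b * s)) (- (b * sin (a + b * t))).
Proof.
rewrite mulrC -mulNr.
exact: is_derive1_comp (is_derive_cos _) (is_derive_affine a b t).
Qed.

Lemma is_derive_sin_affine a b t :
  is_derive t 1 (fun s => sin (a + b * s)) (b * cos (a + b * t)).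
Proof.
rewrite mulrC.
exact: is_derive1_comp (is_derive_sin _) (is_derive_affine a b t).
Qed.

Lemma tangent_in_disk_at rad x y (S : set (R * R)) t dx dy : 0 <= t ->
  norm2 (x t, y t) <= rad -> S (x t, y t) ->
  is_derive t 1 x dx -> is_derive t 1 y dy ->
  (dx, dy) != (0, 0) -> x t * dx + y t * dy = 0 -> tangent_in_disk rad x y S.
Proof.
move=> t0 xyD xyS [xt xtE] [yt ytE] /eqP dxy0 orth.
by exists t; split => //; split; rewrite ?xtE ?ytE.
Qed.

(** At the point where the radius of the trajectory is carried by the line
    through the origin and the centre [p], pointing towards the origin, the
    position is a multiple of the radius, and therefore orthogonal to the
    velocity.  A negative [rho] stands for a motion whose phase is shifted by
    half a turn; this lets one statement serve both signs of the radius of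
    curvature [vel / omega] of the path of the midpoint, and both
    endpoints. *)
Lemma circular_motion_tangent rad om rho chi p x y :
  om != 0 -> rho != 0 -> `|norm2 p - `|rho| | <= rad ->
  x = (fun t => p.1 + rho * cos (chi + om * t)) ->
  y = (fun t => p.2 + rho * sin (chi + om * t)) ->
  tangent_in_disk rad x y
    [set a | a.1 ^+ 2 + a.2 ^+ 2 = (norm2 p - `|rho|) ^+ 2].
Proof.
move=> om0 rho0 dD -> ->.
have [a [b [ab1 pE]]] := norm2_polar p.
set d := norm2 p in dD pE *.
have sg2 : Num.sg rho ^+ 2 = 1 by rewrite sqr_sg rho0.
(* the radius vector is then opposite to [(a, b)], whatever the sign of [rho] *)
have [] := @hitting_time chi om (- Num.sg rho * a) (- Num.sg rho * b) om0.
  by rewrite !exprMn sqrrN sg2 !mul1r.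
move=> t [t0 ct st].
have rsg : rho * Num.sg rho = `|rho| by rewrite mulrC -normrEsg.
have xt : p.1 + rho * cos (chi + om * t) = (d - `|rho|) * a.
  by rewrite ct {1}pE /= mulNr mulrN mulrA rsg mulrBl.
have yt : p.2 + rho * sin (chi + om * t) = (d - `|rho|) * b.
  by rewrite st {1}pE /= mulNr mulrN mulrA rsg mulrBl.
have nxy :
    ((d - `|rho|) * a) ^+ 2 + ((d - `|rho|) * b) ^+ 2 = (d - `|rho|) ^+ 2.
  by rewrite !exprMn -mulrDr ab1 mulr1.
apply: (@tangent_in_disk_at _ _ _ _ t (- (rho * (om * sin (chi + om * t))))
   (rho * (om * cos (chi + om * t)))) => //=.
- by rewrite xt yt /norm2 /= nxy sqrtr_sqr.
- by rewrite xt yt.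
- have := is_derive_cos_affine chi om t => ?.
  by apply: is_derive_eq; rewrite add0r mul1r [_ *: _]mulrN.
- have := is_derive_sin_affine chi om t => ?.
  by apply: is_derive_eq; rewrite add0r mul1r.
- apply/eqP => -[/eqP + /eqP]; rewrite oppr_eq0 !mulf_eq0.
  rewrite (negPf rho0) (negPf om0) /= => /eqP s0 /eqP c0.
  have /eqP := cos2Dsin2 (chi + om * t).
  by rewrite s0 c0 expr0n addr0 eq_sym oner_eq0.
- by rewrite xt yt ct st; ring.
Qed.

End Tangency.

(** * Elastic reflection of a velocity *)

Section Bounce.
Context {R : realType} (mass inertia : R).
Hypotheses (mass_gt0 : 0 < mass) (inertia_gt0 : 0 < inertia).
Implicit Types n u : R * R.

Definition dot n u : R := n.1 * u.1 + n.2 * u.2.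

(** The squared length of a covector for the kinetic energy
    [inertia * u.1 ^+ 2 + mass * u.2 ^+ 2]. *)
Definition cometric n : R := n.1 ^+ 2 / inertia + n.2 ^+ 2 / mass.

(** The orthogonal reflection, for the kinetic energy, across the line
    [dot n u = 0]. *)
Definition bounce n u : R * R :=
  let k := 2 * dot n u / cometric n in
  (u.1 - k * (n.1 / inertia), u.2 - k * (n.2 / mass)).

Lemma cometric_gt0 n : n.2 != 0 -> 0 < cometric n.
Proof.
move=> n2; rewrite ltr_wpDl ?divr_gt0 //; last by rewrite exprn_even_gt0.
by rewrite divr_ge0 ?sqr_ge0 // ltW.
Qed.

Lemma dot_bounce n u : n.2 != 0 -> dot n (bounce n u) = - dot n u.
Proof.
move=> /cometric_gt0; rewrite /bounce => /lt0r_neq0 D0; rewrite /dot /=.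
set k := _ / cometric n.
have -> : n.1 * (u.1 - k * (n.1 / inertia)) + n.2 * (u.2 - k * (n.2 / mass))
  = dot n u - k * cometric n by rewrite /dot /cometric; ring.
by rewrite divfK // /dot; ring.
Qed.

Lemma bounceK n : n.2 != 0 -> involutive (bounce n).
Proof.
move=> n2 u; rewrite {1}/bounce dot_bounce // /bounce mulrN mulNr /=.
by apply: injective_projections => /=; rewrite mulNr opprK subrK.
Qed.

(** Together with [bounceK], this makes two impacts with opposite covectors
    cancel. *)
Lemma bounceN n u : bounce (- n) u = bounce n u.
Proof.
rewrite /bounce.
have -> : dot (- n) u = - dot n u by rewrite /dot /=; ring.
have -> : cometric (- n) = cometric n by rewrite /cometric /= !sqrrN.
by apply: injective_projections => /=; ring.
Qed.

Lemma bounce0 n : bounce n 0 = 0.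
Proof. by rewrite /bounce /dot /= !(mulr0, addr0, mul0r, subr0). Qed.

Lemma bounce_neq0 n u : n.2 != 0 -> u != 0 -> bounce n u != 0.
Proof.
by move=> n2; apply: contra_neq => b0; rewrite -(bounceK n2 u) b0 bounce0.
Qed.

End Bounce.

(** * The billiard map is an involution up to rotations *)

Section Billiard.
Context {R : realType} (rad len mass inertia : R).
Hypotheses (rad_gt0 : 0 < rad) (len_gt0 : 0 < len).
Hypotheses (mass_gt0 : 0 < mass) (inertia_gt0 : 0 < inertia).
Implicit Types z w : state R.

Local Notation front := (Defs.front rad len).
Local Notation impact := (Defs.impact rad len).
Local Notation dh := (Defs.dh rad len).
Local Notation Iplus := (Defs.Iplus rad len).
Local Notation Omega := (Defs.Omega rad len).
Local Notation Ro := (Defs.Ro rad len).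
Local Notation T := (Defs.T rad len mass inertia).
Local Notation Tinv := (Defs.Tinv rad len mass inertia).
Local Notation Tpow := (Defs.Tpow rad len mass inertia).
Local Notation fcaustic := (Defs.fcaustic rad len).
Local Notation midpoint := (Defs.midpoint rad len).
Local Notation rot_center := (Defs.rot_center rad len).
Local Notation dist := (Defs.dist rad len).
Local Notation C0 := (Defs.C0 rad len).
Local Notation C1 := (Defs.C1 rad len mass inertia).
Local Notation smooth_dynamics := (Defs.smooth_dynamics rad len).
Local Notation trace_tangent := (Defs.trace_tangent rad len).

Definition side z : R := if front z then 1 else -1.

Definition velocity z : R * R := (omega z, vel z).

(** The covector such that [dh z] is its pairing with the velocity. *)
Definition normal z : R * R := (side z * len * sinS (vth z), cosS (vth z)).

Lemma side_sq z : side z ^+ 2 = 1.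
Proof. by rewrite /side; case: ifP => _; rewrite ?sqrrN expr1n. Qed.

Lemma impactE z :
  impact z = (velocity z != 0) && (len / rad < side z * cosS (vth z)).
Proof.
rewrite /Defs.impact /back /side /Defs.front.
case: (_ != _) => //=; case: ifPn => [c_gt|_]; first by rewrite mul1r c_gt.
by rewrite mulN1r.
Qed.

Lemma impact_cos z : impact z -> len < rad * (side z * cosS (vth z)).
Proof. by rewrite impactE => /andP[_]; rewrite ltr_pdivrMr // mulrC. Qed.

Lemma normal2_neq0 z : impact z -> (normal z).2 != 0.
Proof.
move=> /impact_cos; apply: contraTneq => /= ->.
by rewrite !mulr0 -leNgt ltW.
Qed.

Lemma dhE z : dh z = dot (normal z) (velocity z).
Proof.
rewrite /Defs.dh /dot /normal /side /=.
by case: ifP => _; ring.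
Qed.

Lemma IplusE z : Iplus z = impact z && (dh z <= 0).
Proof.
rewrite /Defs.Iplus /RIplus /TI -andb_orr.
by rewrite [dh z <= 0]le_eqVlt orbC.
Qed.

Lemma Iplus_impact z : Iplus z -> impact z.
Proof. by rewrite IplusE => /andP[]. Qed.

(** With [omega z = 0], vanishing of [dh] would force [vel z = 0]; so a
    pure translation is never tangential. *)
Lemma RIv_plusE z : Iplus z -> RIv_plus rad len z = (omega z == 0).
Proof.
move=> zI; have zi := Iplus_impact zI.
rewrite /RIv_plus /RIplus zi /=; case: eqVneq => [om0|]; last by rewrite andbF.
move: zI; rewrite andbT IplusE zi le_eqVlt => /orP[|//].
rewrite dhE /dot /= om0 mulr0 add0r mulf_eq0 (negPf (normal2_neq0 zi)) /=.
by move: zi; rewrite impactE /velocity om0 => /andP[+ _ /eqP v0];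
  rewrite v0 eqxx.
Qed.

Definition rotate (a : S1 R) z : state R :=
  State (phi z + a) (vth z) (omega z) (vel z).

Lemma rotate_inj a : injective (rotate a).
Proof.
by move=> [p t o v] [p' t' o' v'] [/addIr -> -> -> ->].
Qed.

Lemma rotateD a b z : rotate a (rotate b z) = rotate (b + a) z.
Proof. by rewrite /rotate /= addrA. Qed.

Lemma rotate0 z : rotate 0 z = z.
Proof. by case: z => *; rewrite /rotate /= addr0. Qed.

Lemma Iplus_rotate a z : Iplus (rotate a z) = Iplus z.
Proof. by []. Qed.

Lemma cosS_orientation z : cosS (orientation z) =
  cosS (phi z) * cosS (vth z) + sinS (phi z) * sinS (vth z).
Proof. by rewrite cosSD cosSN sinSN mulrN opprK. Qed.

Lemma sinS_orientation z : sinS (orientation z) =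
  sinS (phi z) * cosS (vth z) - cosS (phi z) * sinS (vth z).
Proof. by rewrite sinSD cosSN sinSN mulrN. Qed.

Lemma midpointE z : midpoint z =
  (rad * cosS (phi z) - side z * len * cosS (orientation z),
   rad * sinS (phi z) - side z * len * sinS (orientation z)).
Proof.
rewrite /Defs.midpoint /side.
by case: ifP => _; rewrite !(mulN1r, mul1r, mulNr, opprK).
Qed.

(** The two squares come from the radial and orthoradial coordinates of the centre
    with respect to the boundary point touched, where [phi] does not occur. *)
Lemma distE z : dist z = Num.sqrt (
   (rad - side z * len * cosS (vth z) + vel z / omega z * sinS (vth z)) ^+ 2
   + (side z * len * sinS (vth z) + vel z / omega z * cosS (vth z)) ^+ 2).
Proof.
rewrite /Defs.dist /norm2 /Defs.rot_center midpointE /=.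
rewrite cosS_orientation sinS_orientation.
congr Num.sqrt; move: (cosS2DsinS2 (phi z)) (cosS2DsinS2 (vth z)).
set C := cosS (phi z); set S := sinS (phi z); set c := cosS _; set s := sinS _.
set k := _ / _; set e := side z.
move=> CS cs.
set A := rad - e * len * c + k * s; set B := e * len * s + k * c.
transitivity ((A ^+ 2 + B ^+ 2) * (C ^+ 2 + S ^+ 2)); last by rewrite CS mulr1.
have -> : rad * C - e * len * (C * c + S * s) + k * - (S * c - C * s) =
    A * C - B * S.
  by rewrite /A /B; ring.
have -> : rad * S - e * len * (S * c - C * s) + k * (C * c + S * s) =
    A * S + B * C.
  by rewrite /A /B; ring.
by ring.
Qed.

Lemma dist_rotate a z : dist (rotate a z) = dist z.
Proof. by rewrite !distE. Qed.

Lemma Omega_rotate a z : Omega (rotate a z) = Omega z.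
Proof.
by rewrite /Defs.Omega /alpha dist_rotate.
Qed.

Lemma fcaustic_rotate a z : fcaustic (rotate a z) = fcaustic z.
Proof. by rewrite /Defs.fcaustic dist_rotate. Qed.

Lemma impact_mapE w : impact_map rad len mass inertia w =
  let u := bounce mass inertia (normal w) (velocity w) in
  State (phi w) (vth w) u.1 u.2.
Proof.
have Dn : Dcoef len mass inertia (vth w) = cometric mass inertia (normal w).
  by rewrite /Dcoef /cometric /= exprMn exprMn side_sq; ring.
rewrite /impact_map !mxE !big_ord_recl !big_ord0 !mxE /= -/(side w) Dn.
rewrite /bounce /dot /=.
move: (cometric _ _ _) (side_sq w) => D.
set e := side w => e2.
congr State.
- (* [normal] brings a factor [e ^+ 2] which the matrix does not have *)
  transitivity (omega w * (1 - 2 * (e ^+ 2 * len ^+ 2) * sinS (vth w) ^+ 2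
                               / (inertia * D))
    + (vel w * - (e * (2 * len * cosS (vth w) * sinS (vth w)
                       / (inertia * D))) + 0)).
    by rewrite e2 mul1r.
  by rewrite invfM; ring.
- by rewrite !invfM; ring.
Qed.

Lemma TE z : T z =
  let u := bounce mass inertia (normal (Ro z)) (velocity z) in
  State (phi z + Omega z) (- vth z + angle pi) u.1 u.2.
Proof. exact: impact_mapE. Qed.

Lemma T_rotate a z : T (rotate a z) = rotate a (T z).
Proof. by rewrite !TE Omega_rotate /rotate /= addrAC. Qed.

(** Stated for any [w] with the right angle, since it is used both before and
    after the impact ([w = Ro z] and [w = T z]). *)
Lemma side_flip z w : impact z -> velocity w != 0 ->
  vth w = - vth z + angle pi -> side w = - side z.
Proof.
rewrite impactE => /andP[vz sz] vw ew; rewrite /side /Defs.front in sz *.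
have lr : 0 < len / rad by rewrite divr_gt0.
rewrite -[_ != _]/(velocity w != 0).
rewrite -[X in _ = - (if X && _ then _ else _)]/(velocity z != 0).
move: sz; rewrite -[X in if X && _ then _ else _]/(velocity z != 0).
rewrite vz vw /= ew cosS_pi_sub; case: ifP => c_gt.
  by case: ifP => // c_lt; lra.
by rewrite mulN1r opprK => ->.
Qed.

Lemma normal_flip z w : impact z -> velocity w != 0 ->
  vth w = - vth z + angle pi -> normal w = - normal z.
Proof.
move=> zi vw ew; rewrite /normal (side_flip zi vw ew) ew.
by rewrite cosS_pi_sub sinS_pi_sub !mulNr.
Qed.

Lemma velocity_impact z : impact z -> velocity z != 0.
Proof. by rewrite impactE => /andP[]. Qed.

Lemma velocity_T z : impact z ->
  velocity (T z) = bounce mass inertia (normal z) (velocity z).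
Proof.
move=> zi; rewrite TE.
have -> : normal (Ro z) = - normal z.
  by apply: (normal_flip zi) => //; exact: velocity_impact zi.
by rewrite bounceN /velocity; case: bounce.
Qed.

Lemma vth_T z : vth (T z) = - vth z + angle pi.
Proof. by rewrite TE. Qed.

Lemma phi_T z : phi (T z) = phi z + Omega z.
Proof. by rewrite TE. Qed.

Lemma velocity_T_neq0 z : impact z -> velocity (T z) != 0.
Proof.
move=> zi; rewrite velocity_T // bounce_neq0 ?velocity_impact //.
exact: normal2_neq0.
Qed.

Lemma normal_T z : impact z -> normal (T z) = - normal z.
Proof.
by move=> zi; rewrite (@normal_flip z) ?velocity_T_neq0 ?vth_T.
Qed.

(** Rolling and bouncing both change the sign of [dh], the former through the
    covector, the latter through the velocity. *)
Lemma Iplus_T z : Iplus z -> Iplus (T z).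
Proof.
rewrite !IplusE => /andP[zi dz]; apply/andP; split.
  rewrite impactE velocity_T_neq0 //= (side_flip zi) ?velocity_T_neq0 ?vth_T //.
  by rewrite cosS_pi_sub mulrNN; move: zi; rewrite impactE => /andP[].
rewrite dhE normal_T // velocity_T //.
set u := bounce _ _ _ _.
have -> : dot (- normal z) u = - dot (normal z) u by rewrite /dot /=; ring.
by rewrite dot_bounce ?normal2_neq0 // opprK -dhE.
Qed.

(** [vth] goes to [pi - vth] and back, while the two impacts reflect the
    velocity along opposite covectors. *)
Lemma TT_rotate z : Iplus z -> exists a, T (T z) = rotate a z.
Proof.
move=> zI; have zi := Iplus_impact zI; have Tzi := Iplus_impact (Iplus_T zI).
exists (Omega z + Omega (T z)).
have : velocity (T (T z)) = velocity z.
  rewrite velocity_T // normal_T // bounceN velocity_T // bounceK //.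
  exact: normal2_neq0.
case eqTT: (T (T z)) => [p t o v]; rewrite /velocity /= => -[-> ->].
have -> : p = phi (T (T z)) by rewrite eqTT.
have -> : t = vth (T (T z)) by rewrite eqTT.
rewrite /rotate !vth_T opprD opprK addrNK; congr State.
by rewrite !phi_T addrA.
Qed.

(** If [T x = T y], then applying [T] once more shows that [x] and [y] differ by
    a rotation; it also relates [T x] to [T y], so it is trivial. *)
Lemma T_inj : {in [set z | Iplus z] &, injective T}.
Proof.
move=> x y; rewrite !inE /= => xI yI Txy.
have [a Tx] := TT_rotate xI; have [b Ty] := TT_rotate yI.
have xy : x = rotate (b - a) y.
  by apply: (@rotate_inj a); rewrite rotateD subrK -Tx -Ty Txy.
have : phi (T x) = phi (T y) + (b - a) by rewrite {1}xy T_rotate.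
rewrite Txy => /eqP; rewrite addrC -subr_eq subrr => /eqP ba0.
by rewrite xy -ba0 rotate0.
Qed.

(** Rotating [T z] so as to undo the rotation in [TT_rotate] gives a preimage of
    [z]. *)
Lemma Tinv_rotate z : Iplus z -> exists a, Tinv z = rotate a (T z).
Proof.
move=> zI; have [a TTz] := TT_rotate zI; exists (- a).
have TzI : Iplus (rotate (- a) (T z)) by rewrite Iplus_rotate; exact: Iplus_T.
rewrite /Defs.Tinv -{1}[z](rotate0) -[0](subrr a) -rotateD -TTz -T_rotate.
by rewrite pinvKV // ?inE //; exact: T_inj.
Qed.

Lemma Tpow_rotate j z : Iplus z ->
  exists a, Tpow j z = rotate a (if odd `|j|%N then T z else z).
Proof.
move=> zI.
(* one argument for both directions of time: [F] is [T] or [Tinv] *)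
have orbit (F : state R -> state R) n :
    (forall w, Iplus w -> exists a, F w = rotate a (T w)) ->
  exists a, iter n F z = rotate a (if odd n then T z else z).
  move=> FT; elim: n => [|n [a IH]]; first by exists 0; rewrite rotate0.
  rewrite iterS IH /=; case: (odd n) => /=.
    have [b ->] := FT _ (Iplus_T zI : Iplus (rotate a (T z))).
    have [c TTz] := TT_rotate zI.
    by exists (c + (a + b)); rewrite T_rotate TTz !rotateD.
  have [b ->] := FT _ (zI : Iplus (rotate a z)).
  by exists (a + b); rewrite T_rotate rotateD.
case: j => n /=.
  by apply: (orbit T n) => w wI; exists 0; rewrite rotate0.
by apply: (orbit Tinv n.+1) => w; exact: Tinv_rotate.
Qed.

(** * The distance from the midpoint to the origin *)

Lemma side_cos_le1 z : side z * cosS (vth z) <= 1.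
Proof.
have := cosS2DsinS2 (vth z); have := side_sq z.
have := sqr_ge0 (side z - cosS (vth z)); have := sqr_ge0 (sinS (vth z)).
by move: (side z) (cosS _) (sinS _) => e c s; nra.
Qed.

Lemma norm2_midpoint z : norm2 (midpoint z) =
  Num.sqrt (rad ^+ 2 + len ^+ 2 - 2 * len * (rad * (side z * cosS (vth z)))).
Proof.
rewrite midpointE /norm2 /= cosS_orientation sinS_orientation.
congr Num.sqrt.
move: (side z) (side_sq z) (cosS2DsinS2 (phi z)) (cosS2DsinS2 (vth z)) => e e2.
set C := cosS (phi z); set S := sinS (phi z); set c := cosS _; set s := sinS _.
move=> CS cs.
transitivity (rad ^+ 2 * (C ^+ 2 + S ^+ 2)
  + e ^+ 2 * len ^+ 2 * (C ^+ 2 + S ^+ 2) * (c ^+ 2 + s ^+ 2)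
  - 2 * len * (rad * (e * c)) * (C ^+ 2 + S ^+ 2)); first by ring.
by rewrite CS cs e2; ring.
Qed.

Lemma len_lt_rad z : impact z -> len < rad.
Proof.
move=> /impact_cos lc; apply: lt_le_trans lc _.
by rewrite -[leRHS]mulr1 ler_pM2l // side_cos_le1.
Qed.

Lemma norm2_midpoint_gt0 z : impact z -> 0 < norm2 (midpoint z).
Proof.
move=> /impact_cos lc; rewrite norm2_midpoint sqrtr_gt0.
have : rad * (side z * cosS (vth z)) <= rad.
  by rewrite -[leRHS]mulr1 ler_pM2l // side_cos_le1.
move: (rad * _) lc => c lc cr.
have : 0 < (rad - len) ^+ 2 by rewrite exprn_gt0 // subr_gt0 (lt_le_trans lc).
by have : 0 <= len * (rad - c) by [rewrite mulr_ge0 ?subr_ge0 // ltW]; nra.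
Qed.

Lemma norm2_midpoint_lt z : impact z -> norm2 (midpoint z) < rad.
Proof.
move=> /impact_cos lc; rewrite norm2_midpoint -[ltRHS]gtr0_norm // -sqrtr_sqr.
rewrite ltr_sqrt ?exprn_gt0 //.
move: (rad * _) lc => c lc.
by have : 0 < len * (c - len) by [rewrite mulr_gt0 ?subr_gt0]; nra.
Qed.

(** * Motion between two impacts *)

Lemma cosS_vth z : cosS (vth z) =
  cosS (phi z) * cosS (orientation z) + sinS (phi z) * sinS (orientation z).
Proof.
rewrite -[vth z](subKr (phi z)) -/(orientation z).
by rewrite cosSD cosSN sinSN mulrN opprK.
Qed.

Lemma sinS_vth z : sinS (vth z) =
  sinS (phi z) * cosS (orientation z) - cosS (phi z) * sinS (orientation z).
Proof.
rewrite -[vth z](subKr (phi z)) -/(orientation z).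
by rewrite sinSD cosSN sinSN mulrN.
Qed.

Lemma smooth_dynamics_orientation z th x y : smooth_dynamics z th x y ->
  th = fun t => th 0 + omega z * t.
Proof.
case=> _ _ dth _ _; apply: eq_of_is_derive dth _ _.
  by move=> t; exact: is_derive_affine.
by rewrite mulr0 addr0.
Qed.

Lemma smooth_dynamics_circular z th x y : omega z != 0 ->
  smooth_dynamics z th x y ->
  x = (fun t => (rot_center z).1 + vel z / omega z * sin (th t)) /\
  y = (fun t => (rot_center z).2 - vel z / omega z * cos (th t)).
Proof.
move=> om0 zD; have thE := smooth_dynamics_orientation zD.
case: zD => th0 p0 _ dx dy.
have [p1 p2] : x 0 = (midpoint z).1 /\ y 0 = (midpoint z).2.
  by move: p0; case: (midpoint z) => ? ? [].
rewrite thE in dx dy *; split.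
  apply: eq_of_is_derive dx _ _ => [t|].
    have := is_derive_sin_affine (th 0) (omega z) t => ?.
    by apply: is_derive_eq; rewrite add0r mul1r [_ *: _]mulrA divfK.
  rewrite mulr0 addr0 -sinS_angle th0 p1 /Defs.rot_center /=.
  by rewrite mulrN subrK.
apply: eq_of_is_derive dy _ _ => [t|].
  have := is_derive_cos_affine (th 0) (omega z) t => ?.
  by apply: is_derive_eq; rewrite add0r mul1r [_ *: _]mulrN opprK mulrA divfK.
rewrite mulr0 addr0 -cosS_angle th0 p2 /Defs.rot_center /=.
by rewrite addrK.
Qed.

Lemma smooth_dynamics_linear z th x y : omega z = 0 ->
  smooth_dynamics z th x y ->
  x = (fun t => (midpoint z).1 + vel z * cosS (orientation z) * t) /\
  y = (fun t => (midpoint z).2 + vel z * sinS (orientation z) * t).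
Proof.
move=> om0 zD; have thE := smooth_dynamics_orientation zD.
case: zD => th0 p0 _ dx dy.
have [p1 p2] : x 0 = (midpoint z).1 /\ y 0 = (midpoint z).2.
  by move: p0; case: (midpoint z) => ? ? [].
have thc t : th t = th 0 by rewrite thE om0 !mul0r.
split.
  apply: eq_of_is_derive dx _ _ => [t|]; last by rewrite mulr0 addr0 p1.
  by rewrite thc -cosS_angle th0; exact: is_derive_affine.
apply: eq_of_is_derive dy _ _ => [t|]; last by rewrite mulr0 addr0 p2.
by rewrite thc -sinS_angle th0; exact: is_derive_affine.
Qed.

(** * Tangency to the caustics *)

(** The contact takes place at the foot of the perpendicular from the origin to
    the line followed by the midpoint; [dh z <= 0] puts it in the future. *)
Lemma trace_tangent_C0_linear z : Iplus z -> omega z = 0 ->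
  trace_tangent z (C0 z).
Proof.
move=> zI om0 th x y zD; have zi := Iplus_impact zI.
have v0 : vel z != 0.
  have := velocity_impact zi; apply: contraNneq => v0.
  by rewrite /velocity om0 v0.
split=> [_|/eqP]; last by rewrite (negPf v0).
have [-> ->] := smooth_dynamics_linear om0 zD.
rewrite /Defs.C0 /Defs.fcaustic RIv_plusE // om0 eqxx.
set c := cosS (orientation z); set s := sinS (orientation z).
have cs1 : c ^+ 2 + s ^+ 2 = 1 by exact: cosS2DsinS2.
have along : (midpoint z).1 * c + (midpoint z).2 * s =
    rad * cosS (vth z) - side z * len.
  rewrite -[side z * len]mulr1 -cs1 cosS_vth midpointE /= -/c -/s.
  by ring.
have across : (midpoint z).2 * c - (midpoint z).1 * s = rad * sinS (vth z).
  by rewrite sinS_vth midpointE /= -/c -/s; ring.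
set p1 := (midpoint z).1 in along across *.
set p2 := (midpoint z).2 in along across *.
(* the time at which the velocity is orthogonal to the position *)
pose t := - (p1 * c + p2 * s) / vel z.
have xt : p1 + vel z * c * t = - (p2 * c - p1 * s) * s.
  transitivity (p1 * (c ^+ 2 + s ^+ 2) + vel z * c * t).
    by rewrite cs1 mulr1.
  by rewrite /t; field.
have yt : p2 + vel z * s * t = (p2 * c - p1 * s) * c.
  transitivity (p2 * (c ^+ 2 + s ^+ 2) + vel z * s * t).
    by rewrite cs1 mulr1.
  by rewrite /t; field.
have nxy : (- (p2 * c - p1 * s) * s) ^+ 2 + ((p2 * c - p1 * s) * c) ^+ 2 =
    (rad * sinS (vth z)) ^+ 2.
  by rewrite -across -[RHS]mulr1 -cs1; ring.
apply: (@tangent_in_disk_at _ _ _ _ _ t (vel z * c) (vel z * s)).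
- have -> : t = (rad * (side z * cosS (vth z)) - len) * - (side z * vel z)
                / vel z ^+ 2.
    rewrite /t along -[X in - (X - _)]mul1r -(side_sq z).
    by field.
  rewrite divr_ge0 ?sqr_ge0 // mulr_ge0 ?subr_ge0 ?(ltW (impact_cos zi)) //.
  have sc : 0 < side z * cosS (vth z).
    by rewrite -(pmulr_rgt0 _ rad_gt0) (lt_trans len_gt0) // impact_cos.
  rewrite oppr_ge0 -(pmulr_lle0 _ sc) mulrACA -expr2 side_sq mul1r.
  by move: zI; rewrite IplusE dhE /dot /= om0 mulr0 add0r mulrC => /andP[].
- rewrite xt yt /norm2 /= nxy sqrtr_sqr normrM gtr0_norm //.
  by rewrite -[leRHS]mulr1 ler_pM2l // sin_max.
- by rewrite /= xt yt nxy !exprMn real_normK ?num_real.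
- exact: is_derive_affine.
- exact: is_derive_affine.
- apply/eqP => -[/eqP + /eqP]; rewrite !mulf_eq0 (negPf v0) /=.
  move=> /eqP c0 /eqP s0; move/eqP: cs1.
  by rewrite c0 s0 expr0n addr0 eq_sym oner_eq0.
- by rewrite xt yt; ring.
Qed.

(** The contact takes place in the table.  For the midpoint, [dist z] and the
    radius of the trajectory differ by at most the distance from the origin to
    the midpoint, by the triangle inequality; for the endpoints, [dist z] and
    [len] are both between 0 and [rad]. *)
Lemma trace_tangent_C0_circular z : Iplus z -> omega z != 0 ->
  trace_tangent z (C0 z).
Proof.
move=> zI om0 th x y zD; have zi := Iplus_impact zI.
have [xE yE] := smooth_dynamics_circular om0 zD.
have thE t : th t = th 0 + omega z * t.
  by rewrite {1}(smooth_dynamics_orientation zD).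
have C0E (rho : R) : fcaustic z = `|dist z - `|rho| | ->
    C0 z = [set a | a.1 ^+ 2 + a.2 ^+ 2 = (norm2 (rot_center z) - `|rho|) ^+ 2].
  by move=> fE; rewrite /Defs.C0 fE real_normK ?num_real.
split=> v0.
  have k0 : - (vel z / omega z) != 0.
    by rewrite oppr_eq0 mulf_neq0 ?invr_eq0 //; exact/eqP.
  rewrite (C0E (- (vel z / omega z))) //; last first.
    rewrite /Defs.fcaustic RIv_plusE // (negPf om0) normrN.
    by case: eqP.
  (* the radius vector of the midpoint is [- vel / omega] times the unit normal,
     which is a quarter of a turn ahead of the orientation *)
  apply: (circular_motion_tangent (om := omega z) (chi := th 0 + pi / 2)) => //.
  - rewrite normrN.
    pose w := (vel z / omega z * - sinS (orientation z),
               vel z / omega z * cosS (orientation z)).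
    have -> : `|vel z / omega z| = norm2 w.
      rewrite /norm2 /=; move: (_ / _) => k.
      by rewrite !exprMn sqrrN -mulrDr addrC cosS2DsinS2 mulr1 sqrtr_sqr.
    apply: le_trans (ler_dist_norm2 _ _) _.
    by rewrite [X in norm2 X](addrK w (midpoint z)) ltW // norm2_midpoint_lt.
  - rewrite xE; apply/funext => t.
    by rewrite [X in cos X]addrAC cosDpihalf mulrNN thE.
  - rewrite yE; apply/funext => t.
    by rewrite [X in sin X]addrAC sinDpihalf mulNr thE.
have cE : rot_center z = midpoint z.
  rewrite /Defs.rot_center v0 !mul0r.
  by apply: injective_projections; rewrite /= addr0.
have xc t : x t = (midpoint z).1 by rewrite xE cE v0 !mul0r addr0.
have yc t : y t = (midpoint z).2 by rewrite yE cE v0 !mul0r subr0.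
have dD : `|norm2 (midpoint z) - len| <= rad.
  have := norm2_midpoint_lt zi; have := len_lt_rad zi.
  move=> lr mr; rewrite ler_distl; apply/andP; split.
    by rewrite (le_trans _ (norm2_ge0 _)) // subr_le0 ltW.
  by rewrite (le_trans (ltW mr)) // lerDr ltW.
have nlen : `|len| = len by rewrite gtr0_norm.
have fE : fcaustic z = `|dist z - `|len| |.
  by rewrite nlen /Defs.fcaustic RIv_plusE // (negPf om0) v0 eqxx.
have len0 : len != 0 by rewrite gt_eqF.
(* the two endpoints move along one circle, with opposite phases *)
rewrite (C0E _ fE) cE; split.
  apply: (circular_motion_tangent (om := omega z) (chi := th 0)) => //.
  - by rewrite nlen.
  - by apply/funext => t; rewrite xc thE.
  - by apply/funext => t; rewrite yc thE.
rewrite -normrN.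
apply: (circular_motion_tangent (om := omega z) (chi := th 0)) => //.
- by rewrite oppr_eq0.
- by rewrite normrN nlen.
- by apply/funext => t; rewrite xc thE mulNr.
- by apply/funext => t; rewrite yc thE mulNr.
Qed.

Lemma trace_tangent_C0 z : Iplus z -> trace_tangent z (C0 z).
Proof.
move=> zI; have [om0|om0] := eqVneq (omega z) 0.
  exact: trace_tangent_C0_linear.
exact: trace_tangent_C0_circular.
Qed.

Lemma trace_tangent_sub z (S S' : set (R * R)) :
  S `<=` S' -> trace_tangent z S -> trace_tangent z S'.
Proof.
move=> SS' zS th x y zD.
have sub x' y' : tangent_in_disk rad x' y' S -> tangent_in_disk rad x' y' S'.
  by case=> t [t0 tD [tS *]]; exists t; split => //; split => //; exact: SS'.
have [vS rS] := zS th x y zD; split=> [/vS/sub//|/rS[/sub ? /sub ?]].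
by split.
Qed.

Lemma C0_rotate a z : C0 (rotate a z) = C0 z.
Proof. by rewrite /Defs.C0 fcaustic_rotate. Qed.

Lemma Iplus_Tpow j z : Iplus z -> Iplus (Tpow j z).
Proof.
move=> zI; have [a ->] := Tpow_rotate j zI.
by rewrite Iplus_rotate; case: ifP => // _; exact: Iplus_T.
Qed.

Lemma trace_tangent_Tpow j z : Iplus z ->
  trace_tangent (Tpow j z) (if odd `|j|%N then C1 z else C0 z).
Proof.
move=> zI; have := trace_tangent_C0 (Iplus_Tpow j zI).
have [a ->] := Tpow_rotate j zI; rewrite C0_rotate.
by case: ifP.
Qed.

Lemma norm2_midpoint_Tpow j z : Iplus z ->
  norm2 (midpoint (Tpow j z)) = norm2 (midpoint z).
Proof.
move=> zI; have zi := Iplus_impact zI.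
have [a ->] := Tpow_rotate j zI.
have -> w : norm2 (midpoint (rotate a w)) = norm2 (midpoint w).
  by rewrite !norm2_midpoint.
case: ifP => // _; rewrite !norm2_midpoint.
rewrite (side_flip zi (velocity_T_neq0 zi) (vth_T z)) vth_T cosS_pi_sub.
by rewrite mulrNN.
Qed.

End Billiard.

Theorem theorem4 (R : realType) (rad len mass inertia : R)
    (hrad : 0 < rad) (hlen : 0 < len) (hmass : 0 < mass)
    (hinertia : 0 < inertia)
    (z0 : state R) (hz0 : Iplus rad len z0) :
  let z := fun j : int => Tpow rad len mass inertia j z0 in
  [/\ forall i : int, Iplus rad len (z i),
      forall i : int,
        trace_tangent rad len (z i) (caustic rad len mass inertia z0),
      forall i : int, trace_tangent rad len (z (2 * i)) (C0 rad len z0),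
      forall i : int,
        trace_tangent rad len (z (2 * i + 1)) (C1 rad len mass inertia z0)
    & exists (a : R * R) (rho : R),
        0 < rho /\ forall i : int, circle a rho (midpoint rad len (z i))].
Proof.
move=> z.
have tangent j :=
  @trace_tangent_Tpow _ _ _ _ _ hrad hlen hmass hinertia j _ hz0.
split=> [i|i|i|i|].
- exact: Iplus_Tpow.
- apply: trace_tangent_sub (tangent i).
  by case: ifP => _ p ?; [right|left].
- by have := tangent (2 * i); rewrite abszM oddM.
- have := tangent (2 * i + 1); suff -> : odd `|(2 * i + 1)%R|%N by [].
  by lia.
- exists 0, (norm2 (midpoint rad len z0)); split.
    exact/norm2_midpoint_gt0/Iplus_impact.
  by move=> i; rewrite /circle /= subr0; exact: norm2_midpoint_Tpow.
Qed.
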